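(* Let $m\ge 1$ and $k\ge 1$ be integers such that every prime factor of $m$ is larger than $k^k$. Then for any subset $S$ of size $k$ of the dicyclic group $\mathrm{Dic}_m$ there is a subset $S'$ of the semidirect product $\mathbb{Z}\rtimes_{\varphi}\mathbb{Z}_4$, where $\varphi(1)=-\mathrm{id}$, such that $S$ and $S'$ are weakly Freiman isomorphic of order $k-1$.
   Context: Groups are written additively even when they are not abelian, and $0$ denotes the identity element. $\mathrm{Dic}_m$ is the group of order $4m$ generated by two elements $s$ and $r$ subject to the relations $r+s=s-r$, $4s=0$, and $2s=mr$. The group $\mathbb{Z}\rtimes_\varphi\mathbb{Z}_4$ with $\varphi(1)=-\mathrm{id}$ is the set $\mathbb{Z}\times\mathbb{Z}_4$ with operation $(x,h)+(y,g)=(x+(-1)^h y,\ h+g)$; equivalently, it is the group generated by $s,r$ subject only to the relations $r+s=s-r$ and $4s=0$. Weak Freiman isomorphisms: let $S$, $S'$ be subsets of groups $V$, $W$ respectively. A map $\phi:S\to S'$ is a weak Freiman homomorphism of order $n$ if for every sequence $(a_1,\dots,a_\ell)$ of pairwise distinct elements of $S$ with $1\le\ell\le n$, $a_1+a_2+\dots+a_\ell=0$ in $V$ implies $\phi(a_1)+\phi(a_2)+\dots+\phi(a_\ell)=0$ in $W$ (for $n=0$ this condition is vacuous). If in addition $\phi$ has an inverse map $\phi^{-1}:S'\to S$ which is also a weak Freiman homomorphism of order $n$, then $\phi$ is a weak Freiman isomorphism of order $n$, and $S$ and $S'$ are weakly Freiman isomorphic of order $n$. *)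

(* Defs.v *)
From HB Require Import structures.
From mathcomp Require Import all_boot all_order all_algebra all_fingroup.
From mathcomp Require Import all_solvable.
From mathcomp Require Import zify ring.

Set Implicit Arguments.
Unset Strict Implicit.
Unset Printing Implicit Defensive.

Import GRing.Theory.

(* All groups are written multiplicatively, since the library has no additive
   notation for noncommutative groups: [x * y], [1] and [x^-1] stand for
   x + y, 0 and -x. *)

(* A map S -> S' is represented by a function on the whole group V that sends
   S into S'; its values outside S are irrelevant. *)
Definition weak_freiman_hom (V W : groupType) (n : nat)
    (S : {pred V}) (S' : {pred W}) (phi : V -> W) : Prop :=
  {in S, forall a, phi a \in S'} /\
  forall a : seq V,
    0 < size a <= n -> uniq a -> {subset a <= S} ->
    (\prod_(x <- a) x)%g = 1%g -> (\prod_(x <- a) phi x)%g = 1%g.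

Definition weak_freiman_iso (V W : groupType) (n : nat)
    (S : {pred V}) (S' : {pred W}) (phi : V -> W) : Prop :=
  weak_freiman_hom n S S' phi /\
  exists psi : W -> V,
    [/\ {in S, cancel phi psi}, {in S', cancel psi phi}
      & weak_freiman_hom n S' S psi].

Definition weakly_freiman_isomorphic (V W : groupType) (n : nat)
    (S : {pred V}) (S' : {pred W}) : Prop :=
  exists phi : V -> W, weak_freiman_iso n S S' phi.

(* The dicyclic group of order 4m, for m > 0: the pair (i, e) is the element
   written additively ir + es (e = 0, 1), so that s + r = -r + s and 2s = mr.
   Lemmas card_dic and Grp_dic below show that this is the group with
   the usual presentation. *)
Definition dic (m : nat) : Type := ('Z_(2 * m) * bool)%type.

HB.instance Definition _ (m : nat) := Finite.copy (dic m) ('Z_(2 * m) * bool)%type.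

Section DicyclicGroup.

Variable m : nat.
Local Open Scope ring_scope.

Definition dic_one : dic m := (0, false).
Definition dic_mul (u v : dic m) : dic m :=
  (u.1 + (-1) ^+ u.2 * v.1 + (u.2 && v.2)%:R * m%:R, u.2 (+) v.2).
Definition dic_inv (u : dic m) : dic m :=
  (if u.2 then u.1 + m%:R else - u.1, u.2).

Lemma dic_double : m%:R + m%:R = 0 :> 'Z_(2 * m).
Proof.
rewrite -natrD addnn -mul2n; case: m => [|n]; first by rewrite muln0.
by apply: pchar_Zp; rewrite mulnS.
Qed.

Lemma dic_opp : - m%:R = m%:R :> 'Z_(2 * m).
Proof. by apply/eqP; rewrite eq_sym -addr_eq0 dic_double. Qed.

Lemma dic_mulA : associative dic_mul.
Proof.
move=> [x a] [y b] [z c]; rewrite /dic_mul /= addbA; congr (_, _).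
case: a b c => [|] [|] [|] /=;
  rewrite ?expr0 ?expr1 ?mul0r ?mul1r ?mulN1r ?opprD ?opprK ?oppr0 ?dic_opp; ring.
Qed.

Lemma dic_mul1 : left_id dic_one dic_mul.
Proof. by case=> x e; rewrite /dic_mul /= expr0 mul1r mul0r add0r addr0. Qed.

Lemma dic_mulV : left_inverse dic_one dic_inv dic_mul.
Proof.
case=> x [|]; rewrite /dic_mul /dic_one /= ?expr0 ?expr1 ?mul0r ?mul1r.
  by congr (_, _); rewrite -dic_double; ring.
by rewrite addNr addr0.
Qed.

HB.instance Definition _ :=
  Finite_isGroup.Build (dic m) dic_mulA dic_mul1 dic_mulV.

End DicyclicGroup.

Lemma card_dic (m : nat) : 0 < m -> #|{: dic m}| = 4 * m.
Proof.
move=> m_gt0; rewrite card_prod card_bool card_ord Zp_cast; last by lia.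
by lia.
Qed.

Section Presentation.

Variable m : nat.
Hypothesis m_gt0 : 0 < m.
Local Open Scope group_scope.

Let r : dic m := (1%R, false).
Let s : dic m := (0%R, true).

Lemma dic_expr (i : nat) : r ^+ i = (i%:R%R, false).
Proof.
elim: i => [|i IHi]; first by rewrite expg0.
rewrite expgS IHi; congr (_, _); rewrite /= expr0 mulrS; ring.
Qed.

Lemma dic_exps : s ^+ 2 = r ^+ m.
Proof. by rewrite dic_expr; congr (_, _); rewrite /= expr1; ring. Qed.

Lemma dic_normal_form (u : dic m) : u = r ^+ u.1 * s ^+ u.2.
Proof.
rewrite dic_expr; case: u => x [|] /=; rewrite ?expg1 ?expg0 ?mulg1;
  rewrite natr_Zp //.
by congr (_, _); rewrite /= expr0; ring.
Qed.

Lemma Grp_dic :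
  [set: dic m] \isog Grp (s : r : r * s = s * r^-1, s ^+ 4, s ^+ 2 = r ^+ m).
Proof.
apply: intro_isoGrp => [|gT G].
  have rs : r * s = s * r^-1.
    by congr (_, _); rewrite /= expr0 expr1; ring.
  have s4 : s ^+ 4 = 1.
    rewrite (expgM s 2 2) dic_exps -expgM dic_expr.
    by congr (_, _); rewrite muln2 -addnn natrD dic_double.
  have gen_dic : <[s]> <*> <[r]> = [set: dic m].
    apply/eqP; rewrite eqEsubset subsetT; apply/subsetP=> u _.
    rewrite (dic_normal_form u).
    by rewrite groupM ?groupX ?mem_gen ?inE ?cycle_id ?orbT.
  apply/existsP; exists (s, r); apply/eqP.
  exact: (congr2 pair gen_dic (congr2 pair rs (congr2 pair s4 dic_exps))).
case/existsP=> -[x y] /= /eqP[defG yx x4 x2].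
have y2m : y ^+ (2 * m) = 1.
  by rewrite mulnC expgM -x2 -expgM x4.
have two_m : (Zp_trunc (2 * m)).+2 = (2 * m)%N by rewrite Zp_cast //; lia.
have ymod i : y ^+ (i %% (Zp_trunc (2 * m)).+2) = y ^+ i.
  by rewrite two_m expg_mod.
pose f (u : dic m) := y ^+ u.1 * x ^+ u.2.
have yD (i j : 'Z_(2 * m)) : y ^+ (i + j)%R = y ^+ i * y ^+ j.
  by rewrite ymod expgD.
have yN (i : 'Z_(2 * m)) : y ^+ (- i)%R = y ^- i.
  by apply/eqP; rewrite -(inj_eq (mulgI (y ^+ i))) -yD subrr mulgV.
have ym : y ^+ (m%:R%R : 'Z_(2 * m)) = x ^+ 2.
  by rewrite x2 Zp_nat ymod.
have xy i : x * y ^+ i = y ^- i * x.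
  elim: i => [|i IHi]; first by rewrite expg0 invg1 mulg1 mul1g.
  rewrite expgSr mulgA IHi -mulgA.
  have -> : x * y = y^-1 * x by apply: (mulgI y); rewrite mulKVg mulgA yx mulgKV.
  by rewrite mulgA -invMg -expgS expgSr.
have fM : {morph f : u v / u * v}.
  move=> [i a] [j b].
  change (y ^+ (i + (-1) ^+ a * j + (a && b)%:R * m%:R)%R * x ^+ (a (+) b)
          = y ^+ i * x ^+ a * (y ^+ j * x ^+ b)).
  rewrite !yD -!mulgA; congr (_ * _).
  case: a b => [|] [|]; cbn [andb addb nat_of_bool];
    rewrite ?expr0 ?expr1 ?mulN1r ?mul1r ?mul0r ?yN ?ym ?expg0 ?expg1 ?mulg1 //.
  - by rewrite [RHS]mulgA xy -mulgA.
  - by rewrite mul1g xy.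
  - by rewrite !mul1g.
  - by rewrite mul1g.
apply/homgP; exists (Morphism (in2W fM)).
rewrite morphimEdom; apply/eqP; rewrite eqEsubset; apply/andP; split.
  apply/subsetP=> _ /imsetP[u _ ->]; rewrite -defG.
  by rewrite groupM ?groupX ?mem_gen ?inE ?cycle_id ?orbT.
rewrite -defG join_subG !cycle_subG; apply/andP; split; apply/imsetP.
  by exists s; rewrite ?inE //= /f /= expg0 mul1g.
exists r; rewrite ?inE //=; change (y = y ^+ (1%:R : 'Z_(2 * m))%R * x ^+ 0).
by rewrite Zp_nat ymod expg1 mulg1.
Qed.

End Presentation.

(* The semidirect product of int by Z/4, where 1 acts as -id. In (-1) ^+ u.2
   the class u.2 is read as its representative in {0, .., 3}. *)
Definition Z_sdprod_Z4 : Type := (int * 'Z_4)%type.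

HB.instance Definition _ := Choice.copy Z_sdprod_Z4 (int * 'Z_4)%type.

Section SemidirectProduct.

Local Open Scope ring_scope.

Definition zz4_one : Z_sdprod_Z4 := (0, 0).
Definition zz4_mul (u v : Z_sdprod_Z4) : Z_sdprod_Z4 :=
  (u.1 + (-1) ^+ u.2 * v.1, u.2 + v.2).
Definition zz4_inv (u : Z_sdprod_Z4) : Z_sdprod_Z4 :=
  (- ((-1) ^+ u.2 * u.1), - u.2).

Lemma zz4_signD (h g : 'Z_4) :
  (-1) ^+ (h + g)%R = (-1) ^+ h * (-1) ^+ g :> int.
Proof.
have -> : (h + g)%R = ((h + g) %% 4)%N :> nat by [].
by rewrite -exprD -signr_odd odd_mod // signr_odd.
Qed.

Lemma zz4_signN (h : 'Z_4) : (-1) ^+ (- h)%R = (-1) ^+ h :> int.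
Proof.
have h0 : (-1) ^+ h != 0 :> int by rewrite signr_eq0.
apply: (mulIf h0).
by rewrite -zz4_signD addNr -expr2 sqrr_sign expr0.
Qed.

Lemma zz4_mulA : associative zz4_mul.
Proof.
move=> [x h] [y g] [z f]; rewrite /zz4_mul /= zz4_signD addrA.
by congr (_, _); ring.
Qed.

Lemma zz4_mul1 : left_id zz4_one zz4_mul.
Proof. by case=> x h; rewrite /zz4_mul /= !add0r expr0 mul1r. Qed.

Lemma zz4_mulr1 : right_id zz4_one zz4_mul.
Proof. by case=> x h; rewrite /zz4_mul /= mulr0 !addr0. Qed.

Lemma zz4_mulV : left_inverse zz4_one zz4_inv zz4_mul.
Proof.
case=> x h; congr (_, _); last exact: addNr.
by rewrite zz4_signN addNr.
Qed.

Lemma zz4_mulrV : right_inverse zz4_one zz4_inv zz4_mul.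
Proof.
case=> x h; congr (_, _); last exact: subrr.
by rewrite /= mulrN mulrA -expr2 sqrr_sign mul1r subrr.
Qed.

HB.instance Definition _ := isGroup.Build Z_sdprod_Z4
  zz4_mulA zz4_mul1 zz4_mulr1 zz4_mulV zz4_mulrV.

End SemidirectProduct.

(* Main.v *)
Require Import Defs.
From HB Require Import structures.
From mathcomp Require Import all_boot all_order all_algebra all_fingroup.
From mathcomp Require Import zify ring.

Import GRing.Theory Num.Theory Order.TTheory.

(** For k = 1 there is no relation to preserve. For k > 1 the hypothesis makes
    m odd, since otherwise 2 would be a prime factor larger than k^k. The
    dicyclic group is then the semidirect product of Z_m by Z_4, an element u
    being determined by its r-exponent x_u modulo m and its image h_u in Z_4
    ([dic_eq]). A product of distinct elements of S has as r-exponent a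
    combination of the x_u with coefficients -1, 0, 1, and these coefficients
    depend only on the order of the factors and on their images in Z_4
    ([r_exp_prod]). In the semidirect product of Z by Z_4 the elements (y_u, h_u)
    multiply by the same rule, with the same coefficients and with integers y_u
    in place of the residues x_u ([prod_lift]).

    It thus suffices to find integers y_u such that a combination with
    coefficients -1, 0, 1 vanishes at y exactly when it vanishes modulo m at x
    ([signed_sums_lift]). Let B be the set of coefficient vectors that vanish at
    x modulo m. A minor of a matrix with rows in B is at most k! in absolute
    value, hence is zero or coprime to m because k! <= k^k. By Cramer's rule, a
    coefficient vector in the rational span of B then already belongs to B
    ([dvdz_of_rat_span]). The other coefficient vectors are outside this span, so
    each vanishes only on a proper subspace of the space orthogonal to B. A
    finite union of proper subspaces does not cover a rational vector space
    ([vector_separating_rows]), and clearing denominators gives y. The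
    differences x_u - x_v are among the combinations, so the map u -> (y_u, h_u)
    is injective on S. *)

(** * Lifting congruences with coefficients -1, 0, 1 to integer equations *)

Section Lifting.

Local Open Scope ring_scope.

Local Notation toQ := (map_mx (intr : int -> rat)).

(** The Leibniz expansion has n! terms, each a signed product of entries. *)
Lemma norm_det_le_fact (n : nat) (M : 'M[int]_n) :
  (forall i j, `|M i j| <= 1) -> `|\det M| <= n`!%:Z.
Proof.
move=> M_le1; apply: le_trans (ler_norm_sum _ _ _) _.
have -> : n`!%:Z = \sum_(s : 'S_n) 1 by rewrite sumr_const card_Sn natz.
apply: ler_sum => s _.
rewrite normrM normrX normrN1 expr1n mul1r normr_prod.
by apply: prodr_ile1 => i _; rewrite normr_ge0 M_le1.
Qed.

Lemma coprime_large_primes (d m N : nat) :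
    (0 < d <= N)%N -> (forall p, prime p -> p %| m -> N < p)%N ->
  coprime d m.
Proof.
move=> /andP[d_gt0 d_leN] large_m.
case: (gcdn d m =P 1%N) => [/eqP //|/eqP g_neq1].
have g_gt1 : (1 < gcdn d m)%N by have := gcdn_gt0 d m; rewrite d_gt0 /=; lia.
have := large_m _ (pdiv_prime g_gt1) (dvdn_trans (pdiv_dvd _) (dvdn_gcdr d m)).
rewrite ltnNge (leq_trans _ d_leN) // dvdn_leq //.
exact: dvdn_trans (pdiv_dvd _) (dvdn_gcdl d m).
Qed.

Lemma toQ_inj (p q : nat) : injective (toQ : 'M_(p, q) -> 'M_(p, q)).
Proof.
move=> A B /matrixP AB; apply/matrixP => i j.
by apply: (@intr_inj rat); have := AB i j; rewrite !mxE.
Qed.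

(** If [B] has rank [r], it has an invertible [r]-by-[r] submatrix [C], of
    determinant at most [k!] in absolute value. The prime factors of [m] being
    larger, [m] is coprime to [\det C]. By Cramer's rule
    [\det C *: a] is an integral combination of rows of [B], hence [m] divides
    [\det C * (a *m x)], and the factor [\det C] can be cancelled. *)
Lemma dvdz_of_rat_span (m k N : nat) (B : 'M[int]_(N, k))
    (a : 'rV[int]_k) (x : 'cV[int]_k) :
    (forall p, prime p -> p %| m -> k`! < p)%N ->
    (forall i j, `|B i j| <= 1) ->
    (forall i, (m %| (B *m x) i ord0)%Z) ->
    (toQ a <= toQ B)%MS ->
  (m %| (a *m x) ord0 ord0)%Z.
Proof.
move=> large_m B_le1 Bx_m aB.
set r := \rank (toQ B).
pose f : 'I_r -> 'I_N := maxrankfun (toQ B).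
have full_rows : row_full (rowsub f (toQ B))^T.
  by rewrite /row_full mxrank_tr; apply: maxrowsub_free.
pose g : 'I_r -> 'I_k := fullrankfun full_rows.
pose B1 := rowsub f B; pose C := mxsub f g B.
have C_unit : toQ C \in unitmx.
  rewrite -unitmx_tr.
  suff -> : (toQ C)^T = rowsub g (rowsub f (toQ B))^T by apply: fullrowsub_unit.
  by apply/matrixP => i j; rewrite !mxE.
have detC_neq0 : \det C != 0.
  by move: C_unit; rewrite unitmxE det_map_mx unitfE intr_eq0.
have r_le_k : (r <= k)%N by apply: rank_leq_col.
have detC_m : coprimez m (\det C).
  rewrite /coprimez /gcdz; apply/eqP; congr Posz; apply/eqP; rewrite gcdnC.
  apply: coprime_large_primes large_m.
  rewrite absz_gt0 detC_neq0 /= -lez_nat.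
  rewrite abszE; apply: le_trans (norm_det_le_fact r C _) _.
    by move=> i j; rewrite mxE.
  by rewrite lez_nat leq_fact.
(* By Cramer's rule \det C times the coefficients of a on the rows of B1 is
   the integer row u. *)
pose u := colsub g a *m \adj C.
have uB1 : \det C *: a = u *m B1.
  apply: toQ_inj; rewrite map_mxZ map_mxM /u map_mxM.
  have /submxP[w w_a] : (toQ a <= toQ B1)%MS.
    by rewrite /B1 map_mxsub eq_maxrowsub.
  have wC : toQ (colsub g a) = w *m toQ C.
    rewrite map_mxsub w_a -mulmx_colsub; congr (_ *m _).
    by apply/matrixP=> i j; rewrite !mxE.
  rewrite wC -(mulmxA w) -map_mxM mul_mx_adj map_scalar_mx mul_mx_scalar.
  by rewrite -scalemxAl -w_a.
suff: (m %| \det C * (a *m x) ord0 ord0)%Z by rewrite Gauss_dvdzr.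
have -> : \det C * (a *m x) ord0 ord0 = (u *m (B1 *m x)) ord0 ord0.
  by rewrite mulmxA -uB1 -scalemxAl [RHS]mxE.
rewrite mxE; apply: rpred_sum => i _; apply: dvdz_mull.
by rewrite mul_rowsub_mx mxE.
Qed.

Lemma clear_denominators (k : nat) (y : 'cV[rat]_k) :
  exists2 d : int, d != 0 & exists z : 'cV[int]_k, toQ z = d%:~R *: y.
Proof.
exists (\prod_j denq (y j 0)).
  by apply/prodf_neq0 => j _; rewrite denq_neq0.
exists (\col_j ((\prod_(i | i != j) denq (y i 0)) * numq (y j 0))).
apply/colP => j; rewrite !mxE [in RHS](bigD1 j) //= !intrM.
by rewrite numqE; ring.
Qed.

Lemma horner_rVpoly_pow (k : nat) (v : 'rV[rat]_k) (t : rat) :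
  (v *m \col_j t ^+ j) ord0 ord0 = (rVpoly v).[t].
Proof.
rewrite (@horner_coef_wide _ k) ?size_poly // mxE.
by apply: eq_bigr => j _; rewrite mxE coef_rVpoly_ord.
Qed.

(** The solutions of [B *m y = 0] are the combinations of the columns of
    [cokermx B], and a row outside the span of [B] vanishes only on a proper
    subspace of them. To avoid these finitely many subspaces at once, [y] is
    taken on the moment curve of coefficients [(1, t, t^2, ...)]: each row to
    avoid becomes a nonzero polynomial in [t]. *)
Lemma vector_separating_rows (k N M : nat)
    (B : 'M[rat]_(N, k)) (A : 'M[rat]_(M, k)) :
  exists y : 'cV[rat]_k, forall i, (row i A *m y == 0) = (row i A <= B)%MS.
Proof.
pose q i := rVpoly (row i A *m cokermx B).
(* At (1, t, t^2, ...) the row of index i takes the value (q i).[t]. *)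
pose Q := \prod_(i | ~~ (row i A <= B)%MS) q i.
have Q_neq0 : Q != 0.
  apply/prodf_neq0 => i; rewrite submxE; apply: contraNneq => q0.
  by apply/eqP/(can_inj rVpolyK); rewrite -/(q i) q0 linear0.
(* More candidates for t than Q can have roots. *)
pose s : seq rat := [seq j%:R | j <- iota 0 (size Q)].
have /allPn[t _ t_root] : ~~ all (root Q) s.
  apply/negP => /(max_poly_roots Q_neq0)/=.
  rewrite map_inj_uniq ?iota_uniq ?size_map ?size_iota ?ltnn.
    by move/(_ isT).
  by move=> i j /eqP; rewrite eqr_nat => /eqP.
exists (cokermx B *m \col_j t ^+ j) => i.
rewrite mulmxA; case: (boolP (row i A <= B)%MS) => [|AB].
  by rewrite submxE => /eqP->; rewrite mul0mx eqxx.
apply: contraNF t_root => /eqP/matrixP/(_ ord0 ord0).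
rewrite horner_rVpoly_pow mxE /root /Q (bigD1 i) //= hornerM => ->.
by rewrite mul0r.
Qed.

(** Take for [B] the rows of [A] on which [x] satisfies the congruence. By
    [dvdz_of_rat_span] these are all the rows of [A] that lie in the rational
    span of [B], so a vector separating that span from the other rows is a
    solution, up to denominators. *)
Lemma int_solution_of_congruences (m k M : nat)
    (A : 'M[int]_(M, k)) (x : 'cV[int]_k) :
    (forall p, prime p -> p %| m -> k`! < p)%N ->
    (forall i j, `|A i j| <= 1) ->
  exists y : 'cV[int]_k, forall i,
    (m %| (A *m x) i ord0)%Z = ((A *m y) i ord0 == 0).
Proof.
move=> large_m A_le1.
pose good i := (m %| (A *m x) i ord0)%Z.
pose B := \matrix_(i, j) (if good i then A i j else 0).
have [yQ AyQ] := vector_separating_rows _ _ _ (toQ B) (toQ A).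
have [d d_neq0 [y yE]] := clear_denominators _ yQ.
have rowE (C : 'M_(M, k)) (z : 'cV[int]_k) i :
    (C *m z) i ord0 = (row i C *m z) ord0 ord0.
  by rewrite -row_mul [RHS]mxE.
have Ay0 i : ((A *m y) i ord0 == 0) = (row i (toQ A) <= toQ B)%MS.
  rewrite -AyQ -[RHS](_ : (d%:~R *: (row i (toQ A) *m yQ) == 0) = _); last first.
    by rewrite scaler_eq0 intr_eq0 (negPf d_neq0).
  rewrite scalemxAr -yE -map_row -map_mxM rowE.
  apply/eqP/eqP => [Ay0|/matrixP/(_ ord0 ord0)].
    by apply/matrixP => a b; rewrite !ord1 mxE Ay0 mxE.
  by rewrite !mxE => /eqP; rewrite intr_eq0 => /eqP.
exists y => i; rewrite Ay0; apply/idP/idP => [good_i|].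
  suff -> : row i (toQ A) = row i (toQ B) by apply: row_sub.
  by apply/rowP => j; rewrite !mxE /good good_i.
rewrite -map_row rowE; apply: dvdz_of_rat_span large_m _ _ => [i' j|i'].
  by rewrite mxE; case: ifP.
rewrite rowE.
case: (boolP (good i')) => good_i'.
  suff -> : row i' B = row i' A by rewrite -rowE.
  by apply/rowP => j; rewrite !mxE good_i'.
suff -> : row i' B = 0 by rewrite mul0mx mxE dvdz0.
by apply/rowP => j; rewrite !mxE (negPf good_i').
Qed.

Lemma sum_indicator (T : finType) (S : {set T}) (z : T -> int) (u : T) :
  u \in S -> \sum_(v in S) (u == v)%:R * z v = z u.
Proof.
move=> Su; rewrite (bigD1 u) //= eqxx mul1r big1 ?addr0 // => v /andP[_ /negPf].
by rewrite eq_sym => ->; rewrite mul0r.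
Qed.

(** The matrix of [int_solution_of_congruences] is the one whose rows are all
    the vectors with coefficients in {-1, 0, 1}. *)
Lemma signed_sums_lift (T : finType) (S : {set T}) (m : nat) (x : T -> int) :
    (forall p, prime p -> p %| m -> #|S|`! < p)%N ->
  exists y : T -> int, forall c : T -> int, (forall v, `|c v| <= 1) ->
    (m %| \sum_(v in S) c v * x v)%Z = (\sum_(v in S) c v * y v == 0).
Proof.
move=> large_m; pose k := #|S|; pose rows := {ffun 'I_k -> 'I_3}.
pose A : 'M[int]_(#|rows|, k) :=
  \matrix_(i, j) (((enum_val i : rows) j : nat)%:Z - 1).
have A_le1 i j : `|A i j| <= 1.
  by rewrite mxE; case: (enum_val i j) => n n_lt3 /=; lia.
have [y yP] := int_solution_of_congruences m k _ A (\col_j x (enum_val j))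
  large_m A_le1.
exists (fun v => \sum_(j < k | enum_val j == v) y j ord0) => c c_le1.
pose f : rows := [ffun j => inord (absz (c (enum_val j) + 1))].
have Af j : A (enum_rank f) j = c (enum_val j).
  rewrite mxE enum_rankK ffunE; have := c_le1 (enum_val j) => c1.
  by rewrite inordK; lia.
have sumE (z : 'cV_k) : (A *m z) (enum_rank f) ord0 =
    \sum_(j < k) c (enum_val j) * z j ord0.
  by rewrite mxE; apply: eq_bigr => j _; rewrite Af.
have := yP (enum_rank f); rewrite !sumE => yPf.
rewrite big_enum_val [in RHS]big_enum_val.
suff -> : \sum_(j < k) c (enum_val j) *
      (\sum_(i < k | enum_val i == enum_val j) y i ord0)
    = \sum_(j < k) c (enum_val j) * y j ord0.
  by rewrite -yPf; congr (_ %| _)%Z; apply: eq_bigr => j _; rewrite mxE.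
apply: eq_bigr => j _; rewrite (big_pred1 j) // => i.
by rewrite (inj_eq enum_val_inj).
Qed.

End Lifting.

(** * From an equivalence of relations to a weak Freiman isomorphism *)

(** Lists of distinct elements of [S] correspond to lists of distinct elements
    of the image, so one equivalence gives both homomorphism properties. *)
Lemma weak_freiman_iso_onto_image (V : finGroupType) (W : groupType) (n : nat)
    (S : {set V}) (phi : V -> W) :
    {in S &, injective phi} ->
    (forall a : seq V, 0 < size a <= n -> uniq a -> {subset a <= S} ->
      ((\prod_(x <- a) x)%g = 1%g <-> (\prod_(x <- a) phi x)%g = 1%g)) ->
  exists S' : {pred W}, weakly_freiman_isomorphic n (mem S) S'.
Proof.
move=> phi_inj phi_prod.
pose S' : pred W := [pred w | [exists u in S, phi u == w]]; exists S', phi.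
pose psi w := odflt 1%g [pick u in S | phi u == w].
have phiS u : u \in S -> phi u \in S'.
  by move=> Su; apply/exists_inP; exists u.
have psiP w : [exists u in S, phi u == w] -> psi w \in S /\ phi (psi w) = w.
  rewrite /psi; case: pickP => [u /andP[Su /eqP phi_u] _ //|none].
  by case/exists_inP=> u Su phi_u; have := none u; rewrite Su phi_u.
split; first by split=> // a sz_a uniq_a aS /phi_prod; apply.
exists psi; split.
- by move=> u Su; have [Spsi phi_psi] := psiP _ (phiS _ Su); apply: phi_inj.
- by move=> w /psiP[].
split=> [w /psiP[] //|b sz_b uniq_b bS'].
have bK : map phi (map psi b) = b.
  rewrite -map_comp -[RHS]map_id; apply/eq_in_map => w /bS' /psiP[_].
  exact: id.
have prod_b : (\prod_(w <- b) w = \prod_(u <- map psi b) phi u)%g.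
  by rewrite -[in LHS]bK big_map.
rewrite prod_b -(big_map psi predT id) => /phi_prod; apply.
- by rewrite size_map.
- by apply: (@map_uniq _ _ phi); rewrite bK.
- by move=> _ /mapP[w /bS' /psiP[Spsi _] ->].
Qed.

(** * The dicyclic group for odd m as a semidirect product *)

Lemma Zp_intr_eq0 (p : nat) (z : int) :
  1 < p -> (z%:~R == 0 :> 'Z_p)%R = (p %| z)%Z.
Proof.
move=> p_gt1; have natE (n : nat) : (n%:R == 0 :> 'Z_p)%R = (p %| n).
  by rewrite -val_eqE /= val_Zp_nat.
case: z => n; first exact: natE.
by rewrite NegzE mulrNz oppr_eq0; apply: natE.
Qed.

Section OddDicyclic.

Variable m : nat.
Hypothesis m_odd : odd m.

Local Open Scope ring_scope.

Let m2_gt1 : (1 < 2 * m)%N.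
Proof. by case: m m_odd => // n _; lia. Qed.

(** The exponent i of the element ir + es, read as an integer. *)
Definition r_exp (u : dic m) : int := (u.1 : nat).

Lemma r_expE (u : dic m) : (r_exp u)%:~R = u.1.
Proof. by rewrite -pmulrn natr_Zp. Qed.

(** [r_exp] picks a representative between 0 and 2m, so that the product is only
    computed modulo 2m. The term m comes from the relation 2s = mr. *)
Lemma r_expM (u v : dic m) :
  ((2 * m)%N %| r_exp (u * v)%g
     - (r_exp u + (-1) ^+ u.2 * r_exp v + (u.2 && v.2)%:R * m%:Z))%Z.
Proof.
rewrite -Zp_intr_eq0 // rmorphB !rmorphD !rmorphM /= !r_expE rmorphXn rmorphN1.
by rewrite -!pmulrn mulrz_nat; case: u v => [i e] [j f]; rewrite /= subrr.
Qed.

Lemma r_expM_mod (u v : dic m) :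
  (m %| r_exp (u * v)%g - (r_exp u + (-1) ^+ u.2 * r_exp v))%Z.
Proof.
have /dvdzP[q exp_uv] := r_expM u v; apply/dvdzP.
exists (2 * q + (u.2 && v.2)%:R); rewrite PoszM in exp_uv; lia.
Qed.

(** The homomorphism r -> 2, s -> 1, when [m] is odd. *)
Definition Z4_part (u : dic m) : 'Z_4 := ((u.1 : nat).*2 + u.2)%:R.

Lemma Z4_partE (u : dic m) : Z4_part u = (2 * r_exp u + (u.2 : nat)%:Z)%:~R.
Proof.
suff -> : 2 * r_exp u + (u.2 : nat)%:Z = ((u.1 : nat).*2 + u.2)%N by [].
by rewrite /r_exp; lia.
Qed.

Lemma Z4_part_eq (u v : dic m) :
  (Z4_part u == Z4_part v) =
  (4 %| (2 * r_exp u + (u.2 : nat)%:Z) - (2 * r_exp v + (v.2 : nat)%:Z))%Z.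
Proof. by rewrite -(Zp_intr_eq0 4) // intrB subr_eq0 -!Z4_partE. Qed.

(** Since [m] is odd, 2m is 2 modulo 4, so that the images 2 of r and 1 of s
    satisfy the relation 2s = mr. *)
Lemma Z4_partM (u v : dic m) : Z4_part (u * v)%g = Z4_part u + Z4_part v.
Proof.
apply/eqP; rewrite !Z4_partE -intrD -subr_eq0 -intrB (Zp_intr_eq0 4) //.
have /dvdzP[q exp_uv] := r_expM u v.
have -> : (u * v)%g.2 = u.2 (+) v.2 by [].
have m_split : m%:Z = 2 * m./2%:Z + 1.
  by have := odd_double_half m; rewrite m_odd; lia.
move/eqP: exp_uv; rewrite subr_eq => /eqP->; rewrite PoszM.
apply/dvdzP; exists (q * m - u.2%:R * r_exp v + (u.2 && v.2)%:R * m./2).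
by move: m_split; case: u.2 v.2 => [] [] /=; lia.
Qed.

Lemma Z4_part_sign (u : dic m) : (-1) ^+ Z4_part u = (-1) ^+ u.2 :> int.
Proof.
rewrite -signr_odd /Z4_part val_Zp_nat // odd_mod // oddD odd_double.
by case: u.2.
Qed.

(** This is where the dicyclic group embeds in the semidirect product of Z_m by
    Z_4. As [m] is odd, the exponent of r is known modulo 2m from its classes
    modulo [m] and modulo 2, and the image in Z_4 gives the latter. *)
Lemma dic_eq (u v : dic m) :
  Z4_part u = Z4_part v -> (m %| r_exp u - r_exp v)%Z -> u = v.
Proof.
move=> /eqP; rewrite Z4_part_eq => h_uv m_uv.
have e_uv : u.2 = v.2 by case: u.2 v.2 h_uv => [|] [|]; lia.
suff : ((2 * m)%N %| r_exp u - r_exp v)%Z.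
  rewrite -Zp_intr_eq0 // intrB !r_expE subr_eq0 => /eqP.
  by case: u v e_uv {h_uv m_uv} => [i e] [j f] /= -> ->.
rewrite PoszM Gauss_dvdz; last first.
  by rewrite coprimezE coprime2n.
rewrite m_uv andbT; move: h_uv; rewrite e_uv; lia.
Qed.

(** The r-exponent of the product of [a] is modulo [m] the sum of the r-exponents
    of its factors, each with a sign given by the number of factors involving s
    that precede it. [signed_coef a v] is the sum of the signs of the
    occurrences of [v]. *)
Fixpoint signed_coef (a : seq (dic m)) (v : dic m) : int :=
  if a is u :: a' then (u == v)%:R + (-1) ^+ u.2 * signed_coef a' v else 0.

Lemma signed_coef_notin a v : v \notin a -> signed_coef a v = 0.
Proof.
elim: a => //= u a IHa; rewrite in_cons negb_or eq_sym => /andP[/negPf-> /IHa->].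
by rewrite mulr0.
Qed.

Lemma signed_coef_le1 a v : uniq a -> `|signed_coef a v| <= 1.
Proof.
elim: a => //= u a IHa /andP[u_a /IHa a_le1]; case: eqP => [<-|_].
  by rewrite signed_coef_notin // mulr0 addr0.
by rewrite add0r normrM normrX normrN1 expr1n mul1r.
Qed.

Section OverSet.

Variable S : {set dic m}.

(** An element moved to the left of a product changes the sign of the
    r-exponents on its right when it involves s. *)
Lemma signed_sum_cons (z : dic m -> int) u a : u \in S ->
  \sum_(v in S) signed_coef (u :: a) v * z v
    = z u + (-1) ^+ u.2 * \sum_(v in S) signed_coef a v * z v.
Proof.
move=> Su; rewrite -(sum_indicator _ S z) // mulr_sumr -big_split /=.
by apply: eq_bigr => v _; rewrite mulrDl mulrA.
Qed.

Lemma r_exp_prod (a : seq (dic m)) : {subset a <= S} ->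
  (m %| r_exp (\prod_(u <- a) u)%g - \sum_(v in S) signed_coef a v * r_exp v)%Z.
Proof.
elim: a => [_|u a IHa aS].
  by rewrite big_nil big1 ?subrr ?dvdz0 // => v _; rewrite mul0r.
rewrite big_cons signed_sum_cons ?aS ?mem_head //.
have /dvdzP[q exp_uv] := r_expM_mod u (\prod_(u <- a) u)%g.
have aS' : {subset a <= S} by move=> v av; rewrite aS // in_cons av orbT.
have /dvdzP[q' exp_a] := IHa aS'.
apply/dvdzP; exists (q + (-1) ^+ u.2 * q').
rewrite mulrDl -mulrA -exp_uv -exp_a; ring.
Qed.

Lemma prod_lift (y : dic m -> int) (a : seq (dic m)) : {subset a <= S} ->
  (\prod_(u <- a) ((y u, Z4_part u) : Z_sdprod_Z4))%g
    = (\sum_(v in S) signed_coef a v * y v, Z4_part (\prod_(u <- a) u)%g).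
Proof.
elim: a => [_|u a IHa aS].
  by rewrite !big_nil big1 // => v _; rewrite mul0r.
rewrite !big_cons signed_sum_cons ?aS ?mem_head // Z4_partM.
rewrite IHa => [|v av]; last by rewrite aS // in_cons av orbT.
by congr (_, _); rewrite /= Z4_part_sign.
Qed.

End OverSet.

End OddDicyclic.

(** * The weak Freiman isomorphism *)

Lemma fact_leq_exp (k : nat) : k`! <= k ^ k.
Proof.
have -> : k ^ k = \prod_(1 <= i < k.+1) k.
  by rewrite prod_nat_const_nat subSS subn0.
rewrite fact_prod big_nat_cond [X in _ <= X]big_nat_cond.
by apply: leq_prod => i; rewrite andbT => /andP[].
Qed.

Theorem proposition3p9 (m k : nat) (m_ge1 : 1 <= m) (k_ge1 : 1 <= k)
    (prime_factors_m : forall p : nat, prime p -> p %| m -> k ^ k < p)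
    (S : {set dic m}) (card_S : #|S| = k) :
  exists S' : {pred Z_sdprod_Z4},
    weakly_freiman_isomorphic (k - 1) (mem S) S'.
Proof.
have [k_le1|k_gt1] := leqP k 1.
  have k1 : k = 1 by lia.
  (* The order is 0, so only injectivity on a singleton is asked for. *)
  apply: (@weak_freiman_iso_onto_image _ _ _ _ (fun=> 1%g)) => [u v|a].
    have /eqP/cards1P[w ->] : #|S| = 1 by rewrite card_S.
    by rewrite !inE => /eqP-> /eqP->.
  by rewrite k1; case: (size a).
have m_odd : odd m.
  apply: contraT => m_even.
  have := prime_factors_m 2 isT; rewrite dvdn2 m_even => /(_ isT).
  have : 2 ^ 2 <= k ^ k.
    by apply: (@leq_trans (2 ^ k)); rewrite ?leq_exp2l ?leq_exp2r //; lia.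
  by lia.
have [|y yP] := signed_sums_lift _ S m (r_exp m).
  move=> p p_prime /(prime_factors_m _ p_prime); rewrite card_S.
  exact/leq_ltn_trans/fact_leq_exp.
pose phi u : Z_sdprod_Z4 := (y u, Z4_part m u).
apply: (@weak_freiman_iso_onto_image _ _ _ _ phi) => [u v Su Sv|a _ uniq_a aS].
  (* Injectivity is the instance of yP with coefficients +1 at u, -1 at v. *)
  case=> y_uv h_uv; apply: dic_eq => //.
  have diffE (z : dic m -> int) :
      (\sum_(w in S) ((u == w)%:R - (v == w)%:R) * z w = z u - z v)%R.
    rewrite (eq_bigr _ (fun w _ => mulrBl _ _ _)) sumrB.
    by rewrite !sum_indicator.
  rewrite -diffE yP ?diffE ?y_uv ?subrr // => w.
  by case: eqP; case: eqP.
rewrite (prod_lift m m_odd S) //.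
set w := (\prod_(u <- a) u)%g.
have exp_w : (m %| r_exp m w)%Z =
    (\sum_(v in S) signed_coef m a v * y v == 0)%R.
  rewrite -yP => [|v]; last exact: signed_coef_le1.
  rewrite -(subrK (\sum_(v in S) signed_coef m a v * r_exp m v)%R (r_exp m w)).
  by rewrite rpredDl ?r_exp_prod.
split=> [w1|[/eqP]].
  move: exp_w; rewrite w1 dvdz0 => /esym/eqP->.
  by congr (_, _).
rewrite -exp_w => m_w h_w; apply: dic_eq => //.
by rewrite subr0.
Qed.
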